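(* For all positive integers $m$ and $n$, $$\mathfrak{pr}(K_n \odot \overline{K}_m) = \max(mn+n,\ p_{n-1}).$$
   Context: All graphs are finite and simple. A coprime labeling of a graph $G$ is an injection $f\colon V(G)\to\{1,2,\dots,k\}$, for some integer $k\ge |V(G)|$, such that $\gcd(f(u),f(v))=1$ whenever $(u,v)\in E(G)$. The minimum coprime number $\mathfrak{pr}(G)$ is the least $k$ for which such a labeling exists. $K_n$ is the complete graph on $n$ vertices and $\overline{K}_m$ is the empty (edgeless) graph on $m$ vertices. The corona $G\odot H$ of $G$ with $H$ is the graph obtained by taking one copy of $G$ and $|V(G)|$ disjoint copies of $H$ and joining the $i$-th vertex of $G$ to every vertex of the $i$-th copy of $H$. $p_k$ denotes the $k$-th prime number ($p_1=2$), with the convention $p_0=1$. *)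

(* Defs.v *)
From mathcomp Require Import all_boot.

Set Implicit Arguments.
Unset Strict Implicit.
Unset Printing Implicit Defensive.

Record sgraph := SGraph {
  vertex :> finType;
  adj : rel vertex;
  adj_sym : symmetric adj;
  adj_irrefl : irreflexive adj }.

Section Complete.
Variable n : nat.
Definition complete_adj : rel 'I_n := [rel i j | i != j].
Lemma complete_adj_sym : symmetric complete_adj.
Proof. by move=> i j; congr negb; apply: eq_sym. Qed.
Lemma complete_adj_irrefl : irreflexive complete_adj.
Proof. by move=> i; apply/negbF/eqxx. Qed.
Definition complete_graph : sgraph :=
  SGraph complete_adj_sym complete_adj_irrefl.
End Complete.

Section Empty.
Variable m : nat.
Definition empty_adj : rel 'I_m := [rel i j | false].
Lemma empty_adj_sym : symmetric empty_adj. Proof. by []. Qed.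
Lemma empty_adj_irrefl : irreflexive empty_adj. Proof. by []. Qed.
Definition empty_graph : sgraph := SGraph empty_adj_sym empty_adj_irrefl.
End Empty.

(* [inr (u, x)] is the vertex [x] of the copy of [H] attached to [u]. *)
Section Corona.
Variables G H : sgraph.
Definition corona_adj : rel (G + G * H)%type := fun a b =>
  match a, b with
  | inl u, inl v => adj u v
  | inl u, inr (v, _) => u == v
  | inr (u, _), inl v => u == v
  | inr (u, x), inr (v, y) => (u == v) && adj x y
  end.
Lemma corona_adj_sym : symmetric corona_adj.
Proof.
move=> [u|[u x]] [v|[v y]] //=; rewrite ?(eq_sym u) //; first exact: adj_sym.
by rewrite adj_sym.
Qed.
Lemma corona_adj_irrefl : irreflexive corona_adj.
Proof. by move=> [u|[u x]] /=; rewrite adj_irrefl ?andbF. Qed.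
Definition corona : sgraph := SGraph corona_adj_sym corona_adj_irrefl.
End Corona.

Section NthPrime.

Lemma ex_prime_above m : exists p, (m < p) && prime p.
Proof. by have [p lt_mp pr_p] := prime_above m; exists p; rewrite lt_mp. Qed.

Definition next_prime m : nat := ex_minn (ex_prime_above m).

(* [nth_prime 0 = 1]; [nth_prime k] is the [k]-th prime for [k >= 1]. *)
Definition nth_prime k : nat := iter k next_prime 1.

Lemma nth_prime_lt k : nth_prime k < nth_prime k.+1.
Proof. by rewrite /= /next_prime; case: ex_minnP => p /andP[]. Qed.

Lemma nth_prime_prime k : 0 < k -> prime (nth_prime k).
Proof.
by case: k => // k _; rewrite /= /next_prime; case: ex_minnP => p /andP[].
Qed.

Lemma ltn_nth_prime j k : (nth_prime j < nth_prime k) = (j < k).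
Proof.
apply: leqW_mono; apply: leq_mono.
by apply: homo_ltn => [y x z|]; [apply: ltn_trans | exact: nth_prime_lt].
Qed.

Lemma nth_prime_inj : injective nth_prime.
Proof.
by move=> i j eq_ij; case: (ltngtP i j) => //; rewrite -ltn_nth_prime eq_ij ltnn.
Qed.

Lemma nth_prime_surj p : prime p -> exists2 k, 0 < k & nth_prime k = p.
Proof.
move=> pr_p; have [|k le_pk min_k] := @ex_minnP (fun k => p <= nth_prime k).
  exists p; elim: {pr_p}p => // p; move/leq_ltn_trans; apply.
  exact: nth_prime_lt.
have k_gt0 : 0 < k.
  by case: k le_pk {min_k} => //; rewrite leqNgt prime_gt1.
exists k => //; apply/eqP; rewrite eqn_leq le_pk andbT.
case: k k_gt0 min_k {le_pk} => // k _ min_k.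
rewrite /= /next_prime; case: ex_minnP => q _; apply.
by rewrite pr_p andbT ltnNge; apply/negP => /min_k; rewrite ltnn.
Qed.

End NthPrime.

Section CoprimeLabeling.
Variable G : sgraph.

Definition coprime_labeling (k : nat) (f : G -> nat) : Prop :=
  [/\ injective f,
      forall v, 1 <= f v <= k
    & forall u v, adj u v -> coprime (f u) (f v)].

(* Boolean form of [exists f, coprime_labeling k f] (see
   [coprime_labelableP]), with the condition [k >= |V(G)|]; labels are taken
   in ['I_k.+1] and [0] is excluded. *)
Definition coprime_labelable (k : nat) : bool :=
  (#|G| <= k) &&
  [exists f : {ffun G -> 'I_k.+1},
    [&& injectiveb f,
        [forall v, 0 < f v]
      & [forall u, forall v, adj u v ==> coprime (f u) (f v)]]].

Lemma coprime_labelableP k :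
  reflect (#|G| <= k /\ exists f, coprime_labeling k f) (coprime_labelable k).
Proof.
apply: (iffP andP) => -[le_Gk].
  move=> /existsP[f /and3P[/injectiveP f_inj /forallP f_gt0 f_cop]].
  split=> //; exists (fun v => f v : nat); split=> [u v /val_inj/f_inj // | v | u v uv].
    by rewrite f_gt0 -ltnS ltn_ord.
  by have /forallP/(_ v)/implyP := forallP f_cop u; apply.
case=> f [f_inj f_bd f_cop]; split=> //; apply/existsP.
have fE v : (inord (f v) : 'I_k.+1) = f v :> nat.
  by rewrite inordK // ltnS; case/andP: (f_bd v).
exists [ffun v => inord (f v)]; apply/and3P; split.
- by apply/injectiveP => u v; rewrite !ffunE => /(congr1 val); rewrite /= !fE => /f_inj.
- by apply/forallP => v; rewrite ffunE fE; case/andP: (f_bd v).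
- apply/forallP => u; apply/forallP => v; apply/implyP => /f_cop.
  by rewrite !ffunE !fE.
Qed.

Lemma ex_coprime_labelable : exists k, coprime_labelable k.
Proof.
pose f (v : G) := nth_prime (enum_rank v).+1.
have f_inj : injective f.
  by move=> u v /nth_prime_inj[] /val_inj/enum_rank_inj.
have f_pr v : prime (f v) by exact: nth_prime_prime.
exists (maxn #|G| (\max_(v : G) f v)); apply/coprime_labelableP.
split; first exact: leq_maxl.
exists f; split=> // [v | u v uv].
  rewrite prime_gt0 //=; apply: leq_trans (leq_maxr _ _).
  exact: (leq_bigmax v).
rewrite prime_coprime // dvdn_prime2 // (inj_eq f_inj).
by apply: contraTneq uv => ->; rewrite adj_irrefl.
Qed.

Definition min_coprime_number : nat := ex_minn ex_coprime_labelable.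

End CoprimeLabeling.

(* Main.v *)
Require Import Defs.
From mathcomp Require Import all_boot zify.

Set Implicit Arguments.
Unset Strict Implicit.
Unset Printing Implicit Defensive.

(** The lower bound: the [n] clique labels are pairwise coprime and distinct, so
their smallest prime factors ([1] for the label [1]) are [n] distinct terms of
the sequence [1, 2, 3, 5, ...], one of which is at least [nth_prime (n - 1)]
and at most the label that it divides ([clique_label_bound]). The other term of
the maximum counts vertices.

For the upper bound, give the clique vertices, the hubs, the labels
[1 = p_0, p_1, ..., p_(n-1)]. At least [m * n] of the integers in
[1, m * n + n] are not hub labels; keep [m * n] of them for the pendant
vertices. The remaining task is to hand them out, [m] to each hub, so that no
label goes to a hub whose prime divides it. Splitting each hub into [m] slots
turns this into a bipartite matching problem, solved by Hall's theorem
([hall_injection]).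

Hall's condition is the inequality [blocked_labels_bound]. A set of labels
can fail to reach a hub only if the prime of that hub divides all of them, so
if [c] hubs are out of reach, there are [(n - c) * m] slots left, and the labels
in the set are multiples of [c] given hub primes. For [c = 1], they are
multiples of a prime [p] other than [p] itself, at most [(m * n + n) / 2 - 1]
of them, which is at most [(n - 1) * m]. For [c >= 2], the largest of the [c]
primes is at least [c + 1] and another one is at least [2], so there are at
most [(m * n + n) / (2 * (c + 1))] labels; this is at most [(n - c) * m] because
[m * n + n <= 2 * m * n] and [n <= (n - c) * (c + 1)]. *)

(** * Hall's marriage theorem *)

(** The submodularity behind Rado's proof of Hall's theorem: [N1] and [N2] are
meant to be [N] with one edge at [a] deleted, a different edge for each, so
that together they still cover [N a]. *)
Lemma card_bigcup_remove_overlap (A B : finType) (N N1 N2 : A -> {set B})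
    (a : A) (S1 S2 : {set A}) :
  (forall x, x != a -> N1 x = N x) -> (forall x, x != a -> N2 x = N x) ->
  N a \subset N1 a :|: N2 a -> a \in S1 -> a \in S2 ->
  #|\bigcup_(x in S1 :|: S2) N x| + #|\bigcup_(x in (S1 :&: S2) :\ a) N x|
    <= #|\bigcup_(x in S1) N1 x| + #|\bigcup_(x in S2) N2 x|.
Proof.
move=> N1E N2E sub aS1 aS2; rewrite -[leqRHS]cardsUI leq_add //.
  apply/subset_leq_card/bigcupsP => x xS; apply/subsetP => b bx.
  have [xa|xa] := eqVneq x a.
    rewrite {x xS}xa in bx; move/subsetP/(_ b bx): sub; rewrite !in_setU.
    by case/orP=> h; apply/orP; [left|right]; apply/bigcupP; exists a.
  move: xS; rewrite !in_setU => /orP[] xS; apply/orP; [left|right];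
    by apply/bigcupP; exists x; rewrite ?N1E ?N2E.
apply/subset_leq_card/bigcupsP => x; rewrite !inE => /and3P[xa x1 x2].
apply/subsetP => b bx; rewrite in_setI; apply/andP; split; apply/bigcupP;
  by exists x; rewrite ?N1E ?N2E.
Qed.

(** Rado's argument: while some [a] has two neighbours, one of the two edges can
be deleted without breaking Hall's condition. If both deletions broke it, on
[S1] and [S2] say, then [card_bigcup_remove_overlap] would contradict the
condition for [S1 :|: S2] and [(S1 :&: S2) :\ a]. Once every [a] has a single
neighbour, the condition for pairs makes that choice injective. *)
Theorem hall_injection (A B : finType) (N : A -> {set B}) :
  (forall S : {set A}, #|S| <= #|\bigcup_(a in S) N a|) ->
  exists2 g : A -> B, injective g & forall a, g a \in N a.
Proof.
have [e] := ubnP (\sum_a #|N a|); elim: e N => // e IH N le_e hallN.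
have [/forallP thin|] := boolP [forall a, #|N a| <= 1].
  have N1 a : exists b, N a == [set b].
    suff /cards1P[b ->] : #|N a| == 1 by exists b.
    by rewrite eqn_leq thin; have := hallN [set a]; rewrite big_set1 cards1.
  pose g a := xchoose (N1 a).
  have gE a : N a = [set g a] by exact/eqP/(xchooseP (N1 a)).
  exists g => [a a' eq_g|a]; last by rewrite gE set11.
  apply/eqP/negPn/negP => neq.
  have := hallN [set a; a'].
  by rewrite bigcup_setU !big_set1 !gE eq_g setUid cards1 cards2 neq.
case/forallPn=> a; rewrite -ltnNge => /card_gt1P[b1 [b2 [b1a b2a neq_b]]].
pose rm b x := if x == a then N x :\ b else N x.
have rmE b x : x != a -> rm b x = N x by rewrite /rm => /negPf->.
have rma b : rm b a = N a :\ b by rewrite /rm eqxx.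
have sub_rm b x : rm b x \subset N x.
  by rewrite /rm; case: eqP => // _; apply: subsetDl.
pose hall b := [forall S : {set A}, #|S| <= #|\bigcup_(x in S) rm b x|].
have rec b : b \in N a -> hall b ->
    exists2 g : A -> B, injective g & forall x, g x \in N x.
  move=> ba hb; have [||g g_inj gN] := IH (rm b).
  - rewrite -ltnS; apply: leq_trans le_e; rewrite ltnS.
    rewrite (bigD1 a) //= [ltnRHS](bigD1 a) //= -addSn leq_add //.
      by rewrite rma [leqRHS](cardsD1 b) ba.
    by apply: leq_sum => x xa; rewrite rmE.
  - by move=> S; move/forallP: hb; apply.
  by exists g => // x; apply: (subsetP (sub_rm b x)).
have [/rec|/forallPn[S1]] := boolP (hall b1); first exact.
rewrite -ltnNge => lt1.
have [/rec|/forallPn[S2]] := boolP (hall b2); first exact.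
rewrite -ltnNge => lt2.
(* A deletion at [a] can only spoil a set that contains [a]. *)
have inS b (S : {set A}) : #|\bigcup_(x in S) rm b x| < #|S| -> a \in S.
  apply: contraTT => aS; rewrite -leqNgt; apply: (leq_trans (hallN S)).
  rewrite (eq_bigr (rm b)) // => x xS; rewrite rmE //.
  by apply: contraNneq aS => <-.
have aS1 := inS _ _ lt1; have aS2 := inS _ _ lt2.
have cover : N a \subset rm b1 a :|: rm b2 a.
  apply/subsetP => b ba; rewrite !rma !inE ba !andbT -negb_and.
  by apply: contra neq_b => /andP[/eqP<-].
have := card_bigcup_remove_overlap (rmE b1) (rmE b2) cover aS1 aS2.
have := hallN (S1 :|: S2); have := hallN ((S1 :&: S2) :\ a).
have := cardsUI S1 S2; have := cardsD1 a (S1 :&: S2).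
rewrite in_setI aS1 aS2 /=; lia.
Qed.

(** * The lower bound *)

Lemma nth_prime_gtn i : i < nth_prime i.
Proof.
by elim: i => // i /leq_ltn_trans; apply; apply: nth_prime_lt.
Qed.

Lemma coprime_nth_prime i j : i != j -> coprime (nth_prime i) (nth_prime j).
Proof.
case: i j => [|i] [|j] // ij; rewrite ?coprime1n ?coprimen1 //.
rewrite prime_coprime ?nth_prime_prime //.
by rewrite dvdn_prime2 ?nth_prime_prime // (inj_eq nth_prime_inj).
Qed.

Lemma not_coprime_nth_prime i x :
  ~~ coprime x (nth_prime i) -> 0 < i /\ nth_prime i %| x.
Proof.
case: i => [|i]; first by rewrite coprimen1.
by rewrite coprime_sym prime_coprime ?negbK // nth_prime_prime.
Qed.

(** Smallest prime factors of distinct pairwise coprime labels are distinct; as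
[pdiv 1 = 1 = nth_prime 0], this includes the one label that can be [1]. *)
Lemma clique_label_bound (n k : nat) (f : 'I_n -> nat) :
  0 < n -> injective f -> (forall i, 0 < f i <= k) ->
  (forall i j, i != j -> coprime (f i) (f j)) -> nth_prime (n - 1) <= k.
Proof.
move=> n_gt0 f_inj f_bd f_cop.
have rank i : exists r, nth_prime r == pdiv (f i).
  have [f1|f_gt1] := leqP (f i) 1.
    by exists 0; have -> : f i = 1 by move: (f_bd i); lia.
  by have [r _ rE] := nth_prime_surj (pdiv_prime f_gt1); exists r; apply/eqP.
pose r i := xchoose (rank i).
have rE i : nth_prime (r i) = pdiv (f i) by exact/eqP/(xchooseP (rank i)).
have r_inj : injective r.
  move=> i j eq_r; apply/eqP/negPn/negP => neq.
  have := f_cop i j neq; apply/negP.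
  have eq_d : pdiv (f i) = pdiv (f j) by rewrite -!rE eq_r.
  have [f1|f_gt1] := leqP (f i) 1.
    have f1i : f i = 1 by move: (f_bd i); lia.
    have [f1j|f_gt1j] := leqP (f j) 1.
      by case/eqP: neq; apply: f_inj; move: (f_bd j); lia.
    by move: (pdiv_prime f_gt1j); rewrite -eq_d f1i.
  apply/negP => cop; have := pdiv_prime f_gt1.
  have : pdiv (f i) %| gcdn (f i) (f j).
    by rewrite dvdn_gcd pdiv_dvd eq_d pdiv_dvd.
  by rewrite (eqP cop) dvdn1 => /eqP->.
have [i le_i] : exists i, n - 1 <= r i.
  apply/existsP; rewrite -[X in is_true X]negbK negb_exists.
  apply/negP => /forallP small.
  have lt_r i : r i < n - 1 by rewrite ltnNge.
  have g_inj : injective (fun i => Ordinal (lt_r i)) by move=> i j [] /r_inj.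
  by have := leq_card _ g_inj; rewrite !card_ord; lia.
have /andP[f_gt0 f_le] := f_bd i.
apply: leq_trans (leq_trans (pdiv_leq f_gt0) f_le).
by rewrite -rE leqNgt ltn_nth_prime -leqNgt.
Qed.

(** * Distributing the pendant labels *)

(** The quotients by [P] lie strictly above [l] and are at most [N %/ P]. Only
[l = 0] and [l = 1] will matter, the latter for multiples of a prime that differ
from it. *)
Lemma size_multiples (s : seq nat) (P l N : nat) :
  0 < P -> uniq s ->
  (forall x, x \in s -> [/\ P %| x, l * P < x & x <= N]) ->
  size s <= N %/ P - l.
Proof.
move=> P_gt0 s_uniq sP.
rewrite -(size_map (divn^~ P)) -(size_iota l.+1 (N %/ P - l)).
apply: uniq_leq_size.
  rewrite map_inj_in_uniq // => x y /sP[Px _ _] /sP[Py _ _] eq_q.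
  by rewrite -(divnK Px) -(divnK Py) eq_q.
move=> _ /mapP[x /sP[Px lx xN] ->]; rewrite mem_iota.
have : l < x %/ P by rewrite -(ltn_pmul2r P_gt0) divnK.
by have := leq_div2r P xN; lia.
Qed.

Section PendantLabels.

Variables m n : nat.
Hypothesis m_gt0 : 0 < m.

Definition hubs : seq nat := [seq nth_prime i | i <- iota 0 n].

Definition pendant_labels : seq nat :=
  take (m * n) [seq x <- iota 1 (m * n + n) | x \notin hubs].

Lemma pendant_labels_uniq : uniq pendant_labels.
Proof. by rewrite take_uniq // filter_uniq // iota_uniq. Qed.

Lemma size_pendant_labels : size pendant_labels = m * n.
Proof.
rewrite size_takel // size_filter.
have := count_predC [in hubs] (iota 1 (m * n + n)); rewrite size_iota.
have le_hubs : count [in hubs] (iota 1 (m * n + n)) <= n.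
  rewrite -[leqRHS](size_iota 0) -(size_map nth_prime) -size_filter.
  apply: uniq_leq_size; first by rewrite filter_uniq // iota_uniq.
  by move=> x; rewrite mem_filter => /andP[].
have -> : count (fun x => x \notin hubs) (iota 1 (m * n + n)) =
  count (predC [in hubs]) (iota 1 (m * n + n)) by exact: eq_count.
lia.
Qed.

Lemma pendant_labelsP x :
  x \in pendant_labels -> (0 < x <= m * n + n) /\ x \notin hubs.
Proof. by move/mem_take; rewrite mem_filter mem_iota add1n ltnS => /andP[]. Qed.

Lemma hub_mem i : i < n -> nth_prime i \in hubs.
Proof. by move=> lt_in; apply/mapP; exists i; rewrite ?mem_iota. Qed.

(** Hall's condition, with [s] the labels and [D] the hubs that none of them may
be attached to. *)
Lemma blocked_labels_bound (s : seq nat) (D : {set 'I_n}) :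
  uniq s -> {subset s <= pendant_labels} ->
  (forall x i, x \in s -> i \in D -> ~~ coprime x (nth_prime i)) ->
  size s <= (n - #|D|) * m.
Proof.
move=> s_uniq s_sub sD.
have [->|s_n0] := eqVneq s [::]; first by [].
have [y ys] : exists y, y \in s.
  by case: s s_n0 {s_uniq s_sub sD} => // y s _; exists y; rewrite mem_head.
have D_gt0 (i : 'I_n) : i \in D -> 0 < i.
  by move=> iD; have [] := not_coprime_nth_prime (sD y i ys iD).
have dvd x (i : 'I_n) : x \in s -> i \in D -> nth_prime i %| x.
  by move=> xs iD; have [] := not_coprime_nth_prime (sD x i xs iD).
have bd x : x \in s -> 0 < x <= m * n + n.
  by move/s_sub/pendant_labelsP=> [].
have [D0|D_n0] := eqVneq D set0.
  rewrite D0 cards0 subn0 mulnC -size_pendant_labels.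
  exact: uniq_leq_size.
(* [D] avoids index [0], so its largest index [i] is at least [#|D|], and
   [nth_prime i > #|D|]. *)
have [j jD] := set0Pn _ D_n0.
case: (@arg_maxnP 'I_n j (mem D) (@nat_of_ord n) jD) => i iD max_i.
have le_Di : #|D| <= i.
  rewrite cardE -(size_map val) -(size_iota 1 i); apply: uniq_leq_size.
    by rewrite map_inj_uniq ?enum_uniq //; apply: val_inj.
  move=> _ /mapP[l lD ->]; rewrite mem_enum in lD.
  by rewrite mem_iota D_gt0 //= add1n ltnS; apply: max_i.
have lt_in := ltn_ord i.
have pi_gt0 : 0 < nth_prime i by apply: leq_ltn_trans (nth_prime_gtn i).
have [D1|[l [lD li]]] : #|D| = 1 \/ exists l, l \in D /\ l != i.
  have [D1|] := leqP #|D| 1.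
    left; move: D1; rewrite leq_eqVlt ltnS leqn0 cards_eq0 (negPf D_n0) orbF.
    by move/eqP.
  case/card_gt1P=> l1 [l2 [l1D l2D neq]]; right.
  have [e|ne] := eqVneq l1 i; last by exists l1.
  by exists l2; split=> //; rewrite -e eq_sym.
- have := @size_multiples s (nth_prime i) 1 (m * n + n) pi_gt0 s_uniq.
  (* The prime itself is a hub label, hence not in [s]. Not counting it is
     essential: for [m = 1] and the prime [2] the bound is an equality. *)
  have h x : x \in s ->
      [/\ nth_prime i %| x, 1 * nth_prime i < x & x <= m * n + n].
    move=> xs; split; [exact: dvd| |by have /andP[] := bd x xs].
    have /andP[x_gt0 _] := bd x xs.
    rewrite mul1n ltn_neqAle dvdn_leq ?dvd // andbT.
    have [_] := pendant_labelsP (s_sub x xs).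
    by apply: contra => /eqP <-; apply: hub_mem.
  move/(_ h) => /leq_trans; apply; rewrite D1.
  have i_gt1 : 1 < nth_prime i.
    by have := D_gt0 i iD; have := nth_prime_gtn i; lia.
  have : (m * n + n) %/ nth_prime i <= (m * n + n) %/ 2 by apply: leq_div2l.
  have : 1 < n by have := D_gt0 i iD; lia.
  nia.
have pl_gt1 : 1 < nth_prime l.
  by have := D_gt0 l lD; have := nth_prime_gtn l; lia.
have := @size_multiples s (nth_prime i * nth_prime l) 0 (m * n + n) _ s_uniq.
have h x : x \in s -> [/\ nth_prime i * nth_prime l %| x,
    0 * (nth_prime i * nth_prime l) < x & x <= m * n + n].
  move=> xs; have /andP[x_gt0 x_le] := bd x xs; split=> //.
  rewrite Gauss_dvd ?dvd //; apply: coprime_nth_prime.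
  by apply: contra li => /eqP/val_inj->.
move=> /(_ _ h); rewrite subn0 => /(_ ltac:(nia)) /leq_trans; apply.
have le_P : #|D|.+1 * 2 <= nth_prime i * nth_prime l.
  by apply: leq_mul => //; have := nth_prime_gtn i; lia.
apply: (leq_trans (leq_div2l _ _ le_P)); first by lia.
have : m * n + n <= (n - #|D|) * m * (#|D|.+1 * 2).
  have : n <= (n - #|D|) * #|D|.+1 by nia.
  nia.
by move/(leq_div2r (#|D|.+1 * 2)); rewrite mulnK.
Qed.

(** Labels are matched into slots by Hall's theorem; there are as many slots as
labels, so the matching is a bijection and its inverse labels the slots. *)
Lemma pendant_assignment : exists h : 'I_n * 'I_m -> nat,
  [/\ injective h, forall u, h u \in pendant_labels
    & forall u, coprime (h u) (nth_prime u.1)].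
Proof.
pose lab (j : 'I_(m * n)) := nth 0 pendant_labels j.
have lab_mem j : lab j \in pendant_labels.
  by rewrite mem_nth // size_pendant_labels.
have lab_inj : injective lab.
  move=> i j /eqP; rewrite nth_uniq ?size_pendant_labels ?pendant_labels_uniq //.
  by move/eqP/val_inj.
pose N j := [set u : 'I_n * 'I_m | coprime (lab j) (nth_prime u.1)].
have [S|g g_inj gN] := @hall_injection _ _ N.
  pose D := [set i : 'I_n | [forall j in S, ~~ coprime (lab j) (nth_prime i)]].
  have -> : \bigcup_(j in S) N j = setX (~: D) [set: 'I_m].
    apply/setP => -[i x]; rewrite !inE andbT negb_forall.
    apply/bigcupP/existsP => -[j].
      by move=> jS; rewrite inE => cop; exists j; rewrite jS negbK.
    by rewrite negb_imply negbK => /andP[jS cop]; exists j; rewrite ?inE.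
  rewrite cardsX cardsT card_ord (cardsCs (~: D)) setCK card_ord.
  have := @blocked_labels_bound [seq lab j | j in S] D.
  rewrite size_map -cardE; apply.
  - by rewrite map_inj_uniq ?enum_uniq.
  - by move=> _ /mapP[j _ ->].
  - move=> _ i /mapP[j jS ->]; rewrite mem_enum in jS.
    by rewrite inE => /forall_inP; apply.
have [|h gK hK] := inj_card_bij g_inj.
  by rewrite card_prod !card_ord mulnC.
exists (lab \o h); split=> [u v /lab_inj /(can_inj hK) //|u|u] /=.
  exact: lab_mem.
by have := gN (h u); rewrite hK inE.
Qed.

End PendantLabels.

(** * The minimum coprime number *)

Lemma card_corona (m n : nat) :
  #|corona (complete_graph n) (empty_graph m)| = m * n + n.
Proof. by rewrite card_sum card_prod !card_ord mulnC addnC. Qed.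

Theorem theorem1p1 (m n : nat) (m_gt0 : 0 < m) (n_gt0 : 0 < n) :
  min_coprime_number (corona (complete_graph n) (empty_graph m)) =
  maxn (m * n + n) (nth_prime (n - 1)).
Proof.
rewrite /min_coprime_number; case: ex_minnP => k /coprime_labelableP.
rewrite card_corona => -[le_k [f [f_inj f_bd f_cop]]] min_k.
apply/eqP; rewrite eqn_leq geq_max le_k /=; apply/andP; split; last first.
  apply: (@clique_label_bound n k (fun i => f (inl i))) => // [i j|i j ij].
    by move/f_inj => [].
  exact: f_cop.
apply: min_k; apply/coprime_labelableP; rewrite card_corona leq_maxl.
split=> //; have [h [h_inj h_mem h_cop]] := pendant_assignment n m_gt0.
pose F (v : corona (complete_graph n) (empty_graph m)) : nat :=
  match v with inl i => nth_prime i | inr u => h u end.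
have hub_neq (i : 'I_n) u : nth_prime i <> h u.
  move=> e; have [_ /negP] := pendant_labelsP (h_mem u); apply.
  by rewrite -e hub_mem.
exists F; split.
- move=> [i|u] [j|v] //=.
  + by move/nth_prime_inj/val_inj->.
  + by move/hub_neq.
  + by move/esym/hub_neq.
  + by move/h_inj->.
- move=> [i|u] /=.
    rewrite (leq_ltn_trans _ (nth_prime_gtn i)) //=.
    apply: leq_trans (leq_maxr _ _).
    by rewrite leqNgt ltn_nth_prime -leqNgt; have := ltn_ord i; lia.
  have [/andP[-> le_h] _] := pendant_labelsP (h_mem u).
  exact: leq_trans le_h (leq_maxl _ _).
- move=> [i|[i x]] [j|[j y]] /=.
  + by move=> ij; apply: coprime_nth_prime.
  + by move/eqP->; rewrite coprime_sym; apply: (h_cop (j, y)).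
  + by move/eqP<-; apply: (h_cop (i, x)).
  + by rewrite andbF.
Qed.
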